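(* Let $P=2S$ and let $\tilde A_1,\dots,\tilde A_P\in\mathbb R^{N\times N}$ be the vertex matrices and $\theta^k_{p,t}$ the vertex coefficients defined in the context. For $p=1,\dots,P$ let $Adj_p\in\mathbb R^{N\times N}$ be the matrix whose $(i,j)$ entry is $0$ if the $(i,j)$ entry of $\tilde A_p$ is zero and $1$ if the $(i,j)$ entry of $\tilde A_p$ is nonzero, and let $Adj_p^c:=\boldsymbol 1-Adj_p$. Let $\tilde K_1,\dots,\tilde K_P\in\mathbb R^{N\times N}$ satisfy the sparsity condition $$\tilde K_p\circ Adj_p^c=0,\qquad p=1,\dots,P.$$ Then, for all $k\in\{0,1,2,\dots\}$, the matrices $$K_t^k=\sum_{p=1}^{P}\theta^k_{p,t}\tilde K_p,\qquad t\in\{0,\dots,T-1\},$$ satisfy $$K_t^k\circ Adj^c=0,\qquad t\in\{0,\dots,T-1\}.$$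
   Context: Notation: $\circ$ denotes element-wise multiplication of matrices and $\boldsymbol 1$ is the $N\times N$ matrix with all entries equal to one. Let $\mathcal G=(\{1,\dots,N\},\mathcal E)$ be a fixed, connected, undirected graph, and let $\mathcal N_i:=\{j:(i,j)\in\mathcal E\}$ be the set of neighbors of node $i$, with the convention that $i\in\mathcal N_i$. $Adj\in\mathbb R^{N\times N}$ is the adjacency matrix, with $(i,j)$ entry $1$ if $j\in\mathcal N_i$ and $0$ otherwise, and $Adj^c:=\boldsymbol 1-Adj$. Let $T\geq 1$ be an integer time horizon. Consider the dynamics over the graph $$x_{i,t+1}=f_i(x_{\mathcal N_i,t},u_{i,t}),\qquad i\in\{1,\dots,N\},\ t\in\{0,\dots,T-1\},$$ where $x_{i,t},u_{i,t}\in\mathbb R$, $x_{\mathcal N_i,t}\in\mathbb R^{|\mathcal N_i|}$ is the vector with components $x_{j,t}$, $j\in\mathcal N_i$, and each $f_i:\mathbb R^{|\mathcal N_i|}\times\mathbb R\to\mathbb R$ is continuously differentiable, with gradient with respect to the input not depending on time. For each $k\in\{0,1,2,\dots\}$ let $(x^k,u^k)$ be a trajectory, i.e. a collection of states and inputs satisfying these dynamics. $A_t^k\in\mathbb R^{N\times N}$ is the state matrix of the linearization at $(x^k,u^k)$ at time $t$: its $(i,j)$ entry is $a^k_{t(i,j)}:=\nabla_{x_{j,t}}f_i(x^k_{\mathcal N_i,t},u^k_{i,t})$ if $j\in\mathcal N_i$, and $0$ otherwise. It is assumed that $a^k_{t(i,j)}\in[a^{min}_{ij},a^{max}_{ij}]$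 for all $k$, all $t\in\{0,\dots,T-1\}$, all $i$ and $j\in\mathcal N_i$, with given real numbers $a^{min}_{ij}<a^{max}_{ij}$. Let $S:=\sum_{i=1}^N|\mathcal N_i|$ and enumerate the pairs $(i,j)$, $i\in\{1,\dots,N\}$, $j\in\mathcal N_i$, by an index $s=1,\dots,S$, writing $a^k_{t(s)},a_s^{min},a_s^{max}$ for the corresponding quantities. The vertex matrices are $\tilde A_p=\underline A_p$ for $p=1,\dots,S$ and $\tilde A_p=\bar A_{p-S}$ for $p=S+1,\dots,2S$, where $\underline A_s$ (respectively $\bar A_s$) is the $N\times N$ matrix with all entries zero except the entry in the position indexed by $s$, which equals $S\,a_s^{min}$ (respectively $S\,a_s^{max}$). The vertex coefficients are $$\theta^k_{p,t}=\frac1S\,\frac{a_p^{max}-a^k_{t(p)}}{a_p^{max}-a_p^{min}}\ \ (p=1,\dots,S),\qquad \theta^k_{p,t}=\frac1S\left(1-\frac{a_{p-S}^{max}-a^k_{t(p-S)}}{a_{p-S}^{max}-a_{p-S}^{min}}\right)\ \ (p=S+1,\dots,2S).$$ *)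

(* Defs.v *)
From HB Require Import structures.
From mathcomp Require Export all_boot all_order all_algebra.
From mathcomp Require Export all_classical all_reals all_analysis.
Export numFieldNormedType.Exports.

Set Implicit Arguments.
Unset Strict Implicit.
Unset Printing Implicit Defensive.

Local Open Scope ring_scope.

Definition hadamard (R : realType) (m n : nat) (A B : 'M[R]_(m, n)) :
  'M[R]_(m, n) := map2_mx *%R A B.

(* The convention "i is a neighbour of itself" is built in, so that the edge
   relation may or may not contain loops. *)
Definition nbr (N : nat) (e : rel 'I_N) (i : 'I_N) : {set 'I_N} :=
  [set j | (j == i) || e i j].

Definition adj (R : realType) (N : nat) (e : rel 'I_N) : 'M[R]_N :=
  \matrix_(i, j) (j \in nbr e i)%:R.

Definition adjc (R : realType) (N : nat) (e : rel 'I_N) : 'M[R]_N :=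
  const_mx 1 - adj R e.

Definition supp_adj (R : realType) (N : nat) (A : 'M[R]_N) : 'M[R]_N :=
  \matrix_(i, j) (A i j != 0)%:R.

Definition supp_adjc (R : realType) (N : nat) (A : 'M[R]_N) : 'M[R]_N :=
  const_mx 1 - supp_adj A.

(* The components x_j, j in [nbr e i], listed in increasing order of j. *)
Definition nbr_state (R : realType) (N : nat) (e : rel 'I_N) (i : 'I_N)
    (x : 'rV[R]_N) : 'rV[R]_#|nbr e i| :=
  \row_m x 0 (enum_val m).

(* The total derivative exists everywhere and depends continuously on the base
   point; as the domain is finite dimensional, pointwise continuity of the
   differential is continuity in operator norm. *)
Definition C1 (R : realType) (V W : normedModType R) (f : V -> W) : Prop :=
  (forall p, differentiable f p) /\
  (forall v, continuous (fun p : V => 'd f p v)).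

Section Dynamics.
Variables (R : realType) (N : nat) (e : rel 'I_N).
Variable f : forall i : 'I_N, 'rV[R]_#|nbr e i| * R -> R.

Definition trajectory (T : nat) (x u : nat -> 'rV[R]_N) : Prop :=
  forall (t : nat) (i : 'I_N), (t < T)%N ->
    x t.+1 0 i = f (nbr_state e i (x t), u t 0 i).

(* For j in [nbr e i], the direction is the basis vector of the component x_j. *)
Definition dstate (i j : 'I_N) (x u : 'rV[R]_N) : R :=
  'D_(nbr_state e i (delta_mx 0 j), 0 : R) (@f i) (nbr_state e i x, u 0 i).

Definition dinput (i : 'I_N) (x u : 'rV[R]_N) : R :=
  'D_(0 : 'rV[R]_#|nbr e i|, 1 : R) (@f i) (nbr_state e i x, u 0 i).

Definition state_mx (x u : 'rV[R]_N) : 'M[R]_N :=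
  \matrix_(i, j) if j \in nbr e i then dstate i j x u else 0.

End Dynamics.

Definition npairs (N : nat) (e : rel 'I_N) : nat := (\sum_(i < N) #|nbr e i|)%N.

Definition enumerates_pairs (N : nat) (e : rel 'I_N)
    (pr : 'I_(npairs e) -> 'I_N * 'I_N) : Prop :=
  injective pr /\
  forall i j : 'I_N, j \in nbr e i <-> exists s, pr s = (i, j).

(* Vertices are indexed by 'I_(S + S): [fintype.split] separates p < S (lower bounds)
   from S <= p (upper bounds, at position p - S). *)
Section Vertices.
Variables (R : realType) (N S : nat) (pr : 'I_S -> 'I_N * 'I_N).
Variables amin amax : 'I_N -> 'I_N -> R.

Definition vertex_mx (p : 'I_(S + S)) : 'M[R]_N :=
  match fintype.split p with
  | inl s => (S%:R * amin (pr s).1 (pr s).2) *: delta_mx (pr s).1 (pr s).2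
  | inr s => (S%:R * amax (pr s).1 (pr s).2) *: delta_mx (pr s).1 (pr s).2
  end.

Definition gap_ratio (A : 'M[R]_N) (s : 'I_S) : R :=
  let: (i, j) := pr s in (amax i j - A i j) / (amax i j - amin i j).

Definition vertex_coef (A : 'M[R]_N) (p : 'I_(S + S)) : R :=
  match fintype.split p with
  | inl s => S%:R^-1 * gap_ratio A s
  | inr s => S%:R^-1 * (1 - gap_ratio A s)
  end.

End Vertices.

(* Main.v *)
Require Import Defs.
From mathcomp Require Import all_boot all_order all_algebra.
From mathcomp Require Import all_classical all_reals all_analysis.
Import Order.TTheory GRing.Theory Num.Theory.
Import numFieldNormedType.Exports.
Local Open Scope ring_scope.

(** The condition [K o Adj^c = 0] says that [K] belongs to the linear space of
    matrices vanishing off the edges of the graph ([hadamard_indicC_eq0]), so a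
    linear combination of matrices satisfying it satisfies it again.  It remains to see that each [Kt p] lies in that space:
    its support is contained in that of the vertex matrix of index [p], whose
    only possibly nonzero entry is at a pair [(i, j)] with [j] a neighbour of
    [i] ([vertex_mx_eq0]). *)

(** Both sparsity conditions, relative to the graph and relative to the support
    of a vertex matrix, are instances of this equivalence. *)
Lemma hadamard_indicC_eq0 (R : realType) (m n : nat)
    (A : 'M[R]_(m, n)) (P : 'I_m -> 'I_n -> bool) :
  hadamard A (const_mx 1 - \matrix_(i, j) (P i j)%:R) = 0 <->
  forall i j, ~~ P i j -> A i j = 0.
Proof.
split=> [/matrixP A0 i j PijN | A0].
  by have := A0 i j; rewrite !mxE (negbTE PijN) subr0 mulr1.
apply/matrixP => i j; rewrite !mxE.
have [Pij | PijN] := boolP (P i j); first by rewrite subrr mulr0.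
by rewrite A0 ?mul0r.
Qed.

Lemma vertex_mx_eq0 (R : realType) (N S : nat) (pr : 'I_S -> 'I_N * 'I_N)
    (amin amax : 'I_N -> 'I_N -> R) (p : 'I_(S + S)) (i j : 'I_N) :
  (forall s, pr s != (i, j)) -> vertex_mx pr amin amax p i j = 0.
Proof.
move=> pr_neq; rewrite /vertex_mx.
have delta0 s : delta_mx (pr s).1 (pr s).2 i j = 0 :> R.
  have := pr_neq s; case: (pr s) => a b /=.
  by rewrite mxE xpair_eqE [i == a]eq_sym [j == b]eq_sym => /negbTE ->.
by case: fintype.split => s; rewrite mxE delta0 mulr0.
Qed.

Theorem proposition2
  (R : realType) (N : nat) (hN : (0 < N)%N)
  (e : rel 'I_N) (e_sym : symmetric e)
  (e_conn : forall i j : 'I_N, connect e i j)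
  (T : nat) (hT : (1 <= T)%N)
  (f : forall i : 'I_N, 'rV[R]_#|nbr e i| * R -> R)
  (f_C1 : forall i : 'I_N, C1 (f i))
  (x u : nat -> nat -> 'rV[R]_N)
  (traj : forall k : nat, trajectory f T (x k) (u k))
  (input_grad : forall (k : nat) (i : 'I_N) (t t' : nat),
     (t < T)%N -> (t' < T)%N ->
     dinput f i (x k t) (u k t) = dinput f i (x k t') (u k t'))
  (amin amax : 'I_N -> 'I_N -> R)
  (a_lt : forall i j : 'I_N, j \in nbr e i -> amin i j < amax i j)
  (a_bnd : forall (k t : nat) (i j : 'I_N), (t < T)%N -> j \in nbr e i ->
     amin i j <= dstate f i j (x k t) (u k t) <= amax i j)
  (pr : 'I_(npairs e) -> 'I_N * 'I_N) (pr_enum : enumerates_pairs pr)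
  (Kt : 'I_(npairs e + npairs e) -> 'M[R]_N)
  (Kt_sparse : forall p,
     hadamard (Kt p) (supp_adjc (vertex_mx pr amin amax p)) = 0) :
  forall k t : nat, (t < T)%N ->
    hadamard
      (\sum_p vertex_coef pr amin amax (state_mx f (x k t) (u k t)) p *: Kt p)
      (adjc R e) = 0.
Proof.
move=> k t _; apply/hadamard_indicC_eq0 => i j jNi.
rewrite summxE big1 // => p _; rewrite mxE.
have -> : Kt p i j = 0; last by rewrite mulr0.
have /hadamard_indicC_eq0 Kt0 := Kt_sparse p.
apply: Kt0; rewrite negbK; apply/eqP/vertex_mx_eq0 => s.
apply: contra jNi => /eqP prs.
by apply/pr_enum.2; exists s.
Qed.
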